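(* For Independent Set in the Late Accept/Reject model, the competitive ratio is $\frac{3\sqrt3}{2}$; that is, there is a strictly $\frac{3\sqrt3}{2}$-competitive online algorithm in this model, and for every real $c<\frac{3\sqrt3}{2}$ no online algorithm in this model is $c$-competitive.
   Context: Online Independent Set (vertex arrival). An input $\sigma$ is a finite simple undirected graph $G=(V,E)$ together with an ordering of its vertices. Vertices arrive one by one in this order; when a vertex arrives, all edges between it and previously arrived vertices are revealed. All online algorithms are deterministic: each decision depends only on the part of the input revealed so far. After each arrival the algorithm maintains a set of currently accepted vertices, which must be an independent set of the graph revealed so far. $\mathrm{ALG}(\sigma)$ is the number of accepted vertices at the end of the input, and $\mathrm{OPT}(\sigma)$ is the maximum cardinality of an independent set of $G$; the objective is maximization. Late Accept/Reject model: in each step the algorithm may accept the newly arrived vertex and any earlier vertices that have not been late-rejected, and it may remove (late-reject) accepted vertices; a late-rejected vertex can never be accepted again. An algorithm $\mathrm{ALG}$ is $c$-competitive if there is a constant $\alpha$ such that $\mathrm{OPT}(\sigma)\le c\,\mathrm{ALG}(\sigma)+\alpha$ for all inputs $\sigma$; it is strictly $c$-competitive if this holds with $\alpha=0$. By convention, ''the competitive ratio is $c$'' includes that the upper bound holds for the strict competitive ratio and the lower bound for the (non-strict) competitive ratio. *)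

(* Defs.v *)
From HB Require Import structures.
From mathcomp Require Import all_boot all_order all_algebra.
From mathcomp Require Import reals.

Set Implicit Arguments.
Unset Strict Implicit.
Unset Printing Implicit Defensive.

Import Order.TTheory GRing.Theory Num.Theory.
Local Open Scope ring_scope.

(* An input with n vertices is a simple graph on 'I_n, where vertex i is the
   (i+1)-st vertex to arrive.  An adjacency matrix is used rather than a [rel]
   so that an algorithm can only depend on which edges are present. *)
Record input (n : nat) := Input {
  adj : 'M[bool]_n;
  adj_simple : [forall u, forall v, adj u v == adj v u]
               && [forall v, ~~ adj v v] }.

HB.instance Definition _ (n : nat) := [isSub for @adj n].

Definition independent n (G : input n) (S : {set 'I_n}) : bool :=
  [forall u in S, forall v in S, ~~ adj G u v].

Definition OPT n (G : input n) : nat :=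
  (\max_(S : {set 'I_n} | independent G S) #|S|)%N.

Definition prefix_adj n (G : input n) k (le_kn : (k <= n)%N) : 'M[bool]_k :=
  \matrix_(u, v) adj G (widen_ord le_kn u) (widen_ord le_kn v).

Fact prefix_simple n (G : input n) k (le_kn : (k <= n)%N) :
  [forall u, forall v, prefix_adj G le_kn u v == prefix_adj G le_kn v u]
  && [forall v, ~~ prefix_adj G le_kn v v].
Proof.
have /andP[/forallP symG /forallP irrG] := adj_simple G.
apply/andP; split; apply/forallP => u; last by rewrite mxE.
by apply/forallP => v; rewrite !mxE; apply: (forallP (symG _)).
Qed.

(* The part of the input revealed by the first k arrivals. *)
Definition prefix_input n (G : input n) k (le_kn : (k <= n)%N) : input k :=
  Input (prefix_simple G le_kn).

(* A deterministic online algorithm returns, for the part of the input revealed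
   by the first k arrivals, the set of vertices accepted after step k.  Its own
   earlier decisions are determined by the prefixes of that same input. *)
Definition online_algorithm := forall k : nat, input k -> {set 'I_k}.

Definition ALG (A : online_algorithm) n (G : input n) : nat := #|A n G|.

(* The set accepted after step k of the run on G, as a set of vertices of G. *)
Definition accepted (A : online_algorithm) n (G : input n) (k : 'I_n.+1) :
    {set 'I_n} :=
  let le_kn : (k <= n)%N := ltn_ord k in
  [set widen_ord le_kn v | v in A k (prefix_input G le_kn)].

(* The vertices late-rejected in the first k steps of the run on G: those that
   were accepted after some step i and no longer accepted after a later step
   j <= k. *)
Definition late_rejected (A : online_algorithm) n (G : input n) (k : 'I_n.+1) :
    {set 'I_n} :=
  [set v | [exists i : 'I_n.+1, exists j : 'I_n.+1,
     [&& (i < j)%N, (j <= k)%N, v \in accepted A G i & v \notin accepted A G j]]].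

(* Independence is required after every step, since every prefix of an input is
   itself an input.  Accepting any vertex revealed so far is allowed, at any
   step, unless it has been late-rejected. *)
Definition late_accept_reject (A : online_algorithm) : Prop :=
  forall n (G : input n),
    independent G (A n G) /\
    forall k : 'I_n.+1, [disjoint accepted A G k & late_rejected A G k].

Definition competitive_with (R : realType) (A : online_algorithm) (c alpha : R)
    : Prop :=
  forall n (G : input n), (OPT G)%:R <= c * (ALG A G)%:R + alpha.

Definition competitive (R : realType) (A : online_algorithm) (c : R) : Prop :=
  exists alpha : R, competitive_with A c alpha.

Definition strictly_competitive (R : realType) (A : online_algorithm) (c : R)
    : Prop :=
  competitive_with A c 0.

(* Main.v *)
(* Write a = sqrt 3.

   Upper bound.  The algorithm keeps an accepted set S and a set X of discarded
   vertices, and replaces S by an independent set T avoiding X whenever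
   |T \ S| >= a |S \ T|, always with |S \ T| as small as possible.  Minimality
   is a Hall-type condition: every subset Z of S \ T has at least a |Z|
   neighbours in T \ S.  For Z = (S \ T) :&: O with O independent, these
   neighbours lie outside O; this keeps invariant
     |X :&: O| <= 1/2 |S :&: O| + a/2 |S \ O|.
   Once no exchange is possible, |O \ X| <= |S :&: O| + a |S \ O|, and the two
   inequalities add up to |O| <= (3 a / 2) |S|.

   Lower bound.  The adversary builds a complete bipartite graph, always adding
   vertices to the side that the algorithm does not currently occupy.  The
   algorithm must keep switching sides, and each switch late-rejects all it
   holds.  Let H i be the number of vertices accepted so far on the current side
   at the end of the i-th period.  At that time it holds at most H i - H (i - 2)
   vertices, while the other side contains at least H (i + 1) - 1, so
   c-competitiveness gives H (i + 1) <= c (H i - H (i - 2)) up to an additive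
   constant.  The recurrence has no positive solution because
   x^3 = c (x^2 - 1) has no root x > 1 when c < 3 a / 2. *)
Require Import Defs.
From mathcomp Require Import all_boot all_order all_algebra.
From mathcomp Require Import reals.
From mathcomp Require Import ring lra.
Import Order.TTheory GRing.Theory Num.Theory.
Local Open Scope ring_scope.

(** * Real inequalities *)
Lemma sqrt3_sqr (R : realType) : (Num.sqrt 3 : R) * Num.sqrt 3 = 3.
Proof. by rewrite -expr2 sqr_sqrtr. Qed.

Lemma sqrt3_gt1 (R : realType) : 1 < Num.sqrt 3 :> R.
Proof. by rewrite -[X in X < _]sqrtr1 ltr_sqrt ?ltr1n. Qed.

(** The cubic [m ^+ 3 - 3 * s / 2 * (m ^+ 2 - 1)] has a double root at [s = Num.sqrt 3]; this double
    root is what singles out the ratio. *)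
Lemma cubic_ratio_bound (R : realType) (m : R) : 0 < m ->
  3 * Num.sqrt 3 / 2 * (1 - 1 / m ^+ 2) <= m.
Proof.
move=> m_gt0; have s2 := sqrt3_sqr R; have s1 := sqrt3_gt1 R.
set s := Num.sqrt 3 in s1 s2 *.
have m2_gt0 : 0 < m ^+ 2 by rewrite exprn_gt0.
rewrite -(ler_pM2r m2_gt0) -subr_ge0.
suff -> : m * m ^+ 2 - 3 * s / 2 * (1 - 1 / m ^+ 2) * m ^+ 2 =
    (m - s) ^+ 2 * (m + s / 2).
  by rewrite mulr_ge0 ?sqr_ge0 //; lra.
have e : s ^+ 3 = 3 * s by rewrite exprS expr2 s2 mulrC.
have -> : (m - s) ^+ 2 * (m + s / 2) =
  m ^+ 3 - 3 * s / 2 * m ^+ 2 + s ^+ 3 / 2 by field.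
by rewrite e; field; rewrite gt_eqF.
Qed.

(** If two consecutive ratios [G i.+1 / G i] are at most [m], the next one is at most [q * m] with
    [q < 1]. The ratios thus shrink geometrically until two consecutive ones are at most 1, and the
    recurrence then makes the next one non-positive. *)
Lemma no_positive_solution (R : realType) (c : R) (G : nat -> R) :
  0 <= c -> c < 3 * Num.sqrt 3 / 2 -> (forall i, 0 < G i) ->
  ~ (forall i, G i.+3 <= c * (G i.+2 - G i)).
Proof.
move=> c_ge0 c_lt G_gt0 G_rec.
set c0 := 3 * Num.sqrt 3 / 2 in c_lt.
pose r i := G i.+1 / G i.
have r_gt0 i : 0 < r i by rewrite divr_gt0.
have r_rec i : r i.+2 <= c * (1 - 1 / (r i * r i.+1)).
  rewrite ler_pdivrMr // -mulrA.
  suff -> : (1 - 1 / (r i * r i.+1)) * G i.+2 = G i.+2 - G i by apply: G_rec.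
  by rewrite /r; field; rewrite !lt0r_neq0.
have r_le i (m : R) : r i <= m -> r i.+1 <= m ->
    r i.+2 <= c * (1 - 1 / m ^+ 2).
  move=> r1 r2; apply: le_trans (r_rec i) _; apply: ler_wpM2l => //.
  have m_gt0 : 0 < m := lt_le_trans (r_gt0 i) r1.
  rewrite lerB // !div1r lef_pV2 ?posrE ?exprn_gt0 ?(mulr_gt0 (r_gt0 _)) //.
  by rewrite expr2; apply: ler_pM (ltW (r_gt0 _)) (ltW (r_gt0 _)) r1 r2.
have r_gt1 : forall i, ~ (r i <= 1 /\ r i.+1 <= 1).
  move=> i [r1 r2]; have := r_le i 1 r1 r2.
  by rewrite expr1n divr1 subrr mulr0 leNgt r_gt0.
have c0_gt0 : 0 < c0 by rewrite /c0; have := sqrt3_gt1 R; lra.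
pose q := c / c0.
have q_ge0 : 0 <= q by rewrite divr_ge0 // ltW.
have q_lt1 : q < 1 by rewrite ltr_pdivrMr // mul1r.
have r_contract i (m : R) : r i <= m -> r i.+1 <= m -> r i.+2 <= q * m.
  move=> r1 r2; apply: le_trans (r_le i m r1 r2) _.
  have m_gt0 : 0 < m := lt_le_trans (r_gt0 i) r1.
  have -> : c = q * c0 by rewrite /q divfK ?gt_eqF.
  by rewrite -mulrA; apply: ler_wpM2l => //; apply: cubic_ratio_bound.
pose B := Num.max (r 0%N) (r 1%N).
have B_gt0 : 0 < B by rewrite lt_max r_gt0.
have bnd k : r k.*2 <= q ^+ k * B /\ r k.*2.+1 <= q ^+ k * B.
  elim: k => [|k [IH1 IH2]]; first by rewrite expr0 mul1r !le_max !lexx orbT.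
  have E := r_contract _ _ IH1 IH2.
  rewrite doubleS exprS -mulrA; split=> //; apply: r_contract => //.
  apply: le_trans E _; apply: ler_piMl (ltW q_lt1).
  by rewrite mulr_ge0 ?exprn_ge0 // ltW.
suff [k kB] : exists k, q ^+ k * B <= 1.
  have [b1 b2] := bnd k; case: (r_gt1 k.*2); split; exact: le_trans kB.
(* A Bernoulli-type bound on the decay of [q ^+ k], which yields an explicit [k]. *)
have bern k : q ^+ k * (1 + k%:R * (1 - q)) <= 1.
  elim: k => [|k IH]; first by rewrite expr0 mul0r addr0 mulr1.
  apply: le_trans IH; rewrite exprSr -mulrA ler_wpM2l ?exprn_ge0 //.
  rewrite -subr_ge0 -natr1.
  suff -> : 1 + k%:R * (1 - q) - q * (1 + (k%:R + 1) * (1 - q)) =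
      (k%:R + 1) * (1 - q) ^+ 2 by rewrite mulr_ge0 ?sqr_ge0 ?addr_ge0.
  by ring.
have d_gt0 : 0 < 1 - q by rewrite subr_gt0.
exists (Num.bound (B / (1 - q))); set k := Num.bound _.
have : B / (1 - q) < k%:R by apply: archi_boundP; rewrite divr_ge0 // ltW.
rewrite ltr_pdivrMr // => Bk; apply: le_trans (bern k).
by rewrite ler_wpM2l ?exprn_ge0 //; lra.
Qed.

(** * The exchange algorithm *)

Lemma adj_sym n (G : input n) u v : adj G u v = adj G v u.
Proof.
have /andP[/forallP symG _] := adj_simple G.
by have /forallP/(_ v)/eqP := symG u.
Qed.

Lemma independentP n (G : input n) (S : {set 'I_n}) :
  reflect {in S &, forall u v, ~~ adj G u v} (independent G S).
Proof.
apply: (iffP forall_inP) => [indS u v uS vS|indS u uS].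
  exact: (forall_inP (indS u uS)).
by apply/forall_inP => v vS; apply: indS.
Qed.

(** [T != S] excludes the trivial exchange, for which the gain inequality reads [0 <= 0]. Adding
    vertices without removing any has no cost, so new arrivals need no separate rule. *)
Definition admissible (R : realType) n (G : input n) (S X T : {set 'I_n}) :=
  [&& independent G T, [disjoint T & X], T != S &
      Num.sqrt 3 * #|S :\: T|%:R <= #|T :\: S|%:R :> R].

Definition exchange (R : realType) n (G : input n)
    (st : {set 'I_n} * {set 'I_n}) : {set 'I_n} * {set 'I_n} :=
  let: (S0, X) := st in
  if [pick T | admissible R n G S0 X T] is Some T0 then
    let T := [arg min_(T < T0 | admissible R n G S0 X T) #|S0 :\: T|] in
    (T, X :|: (S0 :\: T))
  else (S0, X).

Variant exchange_spec (R : realType) n (G : input n) (S X : {set 'I_n}) :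
    {set 'I_n} * {set 'I_n} -> Prop :=
  | ExchangeNone of (forall T, ~~ admissible R n G S X T) :
      exchange_spec R n G S X (S, X)
  | ExchangeSome T of admissible R n G S X T
      & (forall T', admissible R n G S X T' -> (#|S :\: T| <= #|S :\: T'|)%N) :
      exchange_spec R n G S X (T, X :|: (S :\: T)).

Lemma exchangeP (R : realType) n (G : input n) S X :
  exchange_spec R n G S X (exchange R n G (S, X)).
Proof.
rewrite /exchange; case: pickP => [T0 adm0|noT].
  by case: arg_minnP => // T admT minT; apply: ExchangeSome.
by apply: ExchangeNone => T; rewrite noT.
Qed.

(** [O] ranges over all independent sets because the final optimum is unknown during the run. *)
Definition rejection_bounded (R : realType) n (G : input n)
    (S X : {set 'I_n}) : Prop :=
  forall O, independent G O ->
  #|X :&: O|%:R <= 1 / 2 * #|S :&: O|%:R + Num.sqrt 3 / 2 * #|S :\: O|%:R :> R.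

Definition invariant_state (R : realType) n (G : input n)
    (st : {set 'I_n} * {set 'I_n}) : Prop :=
  [/\ independent G st.1, [disjoint st.1 & st.2]
    & rejection_bounded R n G st.1 st.2].

(* Exchanging only the part of S :\: T outside Z is not admissible, by
   minimality, so Z alone accounts for at least sqrt 3 * #|Z| of the gain. *)
Lemma minimal_expansion (R : realType) n (G : input n) (S X T Z : {set 'I_n}) :
  independent G S -> [disjoint S & X] -> admissible R n G S X T ->
  (forall T', admissible R n G S X T' -> (#|S :\: T| <= #|S :\: T'|)%N) ->
  Z \subset S :\: T ->
  Num.sqrt 3 * #|Z|%:R <=
    #|[set y in T :\: S | [exists z in Z, adj G z y]]|%:R :> R.
Proof.
move=> indS dSX /and4P[/independentP indT dTX TS gain] minT sZ.
have [->|Z0] := eqVneq Z set0; first by rewrite cards0 mulr0.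
set NZ := [set y in _ | _].
pose Y' := (T :\: S) :\: NZ.
(* [T'] keeps [Z] and forgoes its neighbours [NZ] among the new vertices, hence stays
   independent. *)
pose T' := (S :&: T) :|: Z :|: Y'.
have zS z : z \in Z -> (z \in S) && (z \notin T).
  by move/(subsetP sZ); rewrite inE andbC.
have DST' : S :\: T' = (S :\: T) :\: Z.
  apply/setP => v; rewrite !inE; case: (boolP (v \in Z)) => vZ /=.
    by rewrite orbT.
  by case: (v \in S); case: (v \in T); rewrite ?andbT ?andbF.
have DT'S : T' :\: S = Y'.
  apply/setP => v; rewrite !inE; case: (boolP (v \in Z)) => vZ /=.
    by have /andP[-> _] := zS v vZ.
  by case: (v \in S); case: (v \in T); rewrite ?andbT ?andbF.
have cZ : (#|S :\: T| = #|Z| + #|(S :\: T) :\: Z|)%N.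
  by rewrite -(cardsID Z (S :\: T)) (setIidPr sZ).
have sN : NZ \subset T :\: S by apply/subsetP => y; rewrite inE => /andP[].
have cN : (#|T :\: S| = #|NZ| + #|Y'|)%N.
  by rewrite -(cardsID NZ (T :\: S)) (setIidPr sN).
have indT' : independent G T'.
  have cross z y : z \in Z -> y \in Y' -> ~~ adj G z y.
    rewrite !inE => zZ /andP[+ /andP[yS yT]]; rewrite yS yT /=.
    by rewrite negb_exists => /forallP/(_ z); rewrite zZ.
  have inST v : v \in T' -> [|| (v \in S) && (v \in T), v \in Z | v \in Y'].
    by rewrite in_setU in_setU in_setI orbA.
  have YT v : v \in Y' -> v \in T by rewrite !inE => /and3P[].
  have ZS v : v \in Z -> v \in S by case/zS/andP.
  move/independentP in indS.
  apply/independentP => u v /inST Hu /inST Hv.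
  case/or3P: Hu => [/andP[uS uT]|uZ|uY]; case/or3P: Hv => [/andP[vS vT]|vZ|vY].
  - exact: indS.
  - by apply: indS => //; apply: ZS.
  - by apply: indT => //; apply: YT.
  - by apply: indS => //; apply: ZS.
  - by apply: indS => //; apply: ZS.
  - exact: cross.
  - by apply: indT => //; apply: YT.
  - by rewrite adj_sym; apply: cross.
  - by apply: indT => //; apply: YT.
have dT'X : [disjoint T' & X].
  apply: (@disjointWl _ _ (mem (S :|: T))).
    apply/subsetP => v; rewrite !inE => /orP[/orP[/andP[->]|/zS/andP[->]]|] //.
    by move=> /and3P[_ _ ->]; rewrite orbT.
  by rewrite -setI_eq0 setIUl !disjoint_setI0 // setU0.
(* Otherwise [T'] would be admissible (strictness also rules out [T' = S]) while removing [#|Z| > 0]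
   fewer vertices than [T]. Subtracting this from [gain] gives the claim. *)
have : Num.sqrt 3 * #|S :\: T'|%:R >= #|T' :\: S|%:R :> R.
  rewrite leNgt; apply/negP => lt'.
  have : admissible R n G S X T'.
    apply/and4P; split=> //; last exact: ltW.
    by apply: contraTneq lt' => ->; rewrite setDv cards0 mulr0 ltxx.
  move/minT; rewrite DST' cZ; apply/negP; rewrite -ltnNge.
  by rewrite -[X in (X < _)%N]add0n ltn_add2r card_gt0.
move: gain; rewrite DST' DT'S cZ cN !natrD; lra.
Qed.

(** The newly discarded vertices of [O] form [Z]. Their neighbours in [T :\: S] lie outside [O],
    where each weighs [s / 2] instead of [1 / 2]. Since [(s - 1) * (s + 1) / 2 = 1], the right-hand
    side grows by at least [#|Z|]. *)
Lemma exchange_invariant (R : realType) n (G : input n) st :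
  invariant_state R n G st -> invariant_state R n G (exchange R n G st).
Proof.
case: st => S X [indS dSX bnd].
case: (exchangeP R n G S X) => [_|T admT minT]; first by split.
rewrite /= in indS dSX bnd.
have /and4P[indT dTX _ gain] := admT; split=> //=.
  rewrite -setI_eq0 setIUr (disjoint_setI0 dTX) set0U.
  by rewrite setIDA setDIl setDv set0I.
move=> O indO; have := bnd O indO.
set s := Num.sqrt 3 in gain *; have s1 := sqrt3_gt1 R; have s2 := sqrt3_sqr R.
rewrite -/s in s1 s2.
pose Z := (S :\: T) :&: O.
have := minimal_expansion R n G S X T Z indS dSX admT minT (subsetIl _ _).
set NZ := [set y in _ | _] => expZ.
have NZO : (#|NZ| <= #|(T :\: S) :\: O|)%N.
  apply: subset_leq_card; apply/subsetP => y.
  rewrite inE => /andP[yTS /exists_inP[z zZ zy]]; rewrite in_setD yTS andbT.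
  apply: contraL zy => yO; apply: (independentP _ _ _ indO) => //.
  by move: zZ; rewrite inE => /andP[].
have cZ : (#|S :\: T| = #|Z| + #|(S :\: T) :\: O|)%N by rewrite cardsID.
have cY : (#|T :\: S| = #|(T :\: S) :&: O| + #|(T :\: S) :\: O|)%N.
  by rewrite cardsID.
have cSO : (#|S :&: O| = #|S :&: T :&: O| + #|Z|)%N.
  by rewrite -(cardsID T) setIAC /Z setIDAC.
have cSN : (#|S :\: O| = #|(S :&: T) :\: O| + #|(S :\: T) :\: O|)%N.
  by rewrite -(cardsID T) setIDAC setDDl [O :|: T]setUC -setDDl.
have cTO : (#|T :&: O| = #|S :&: T :&: O| + #|(T :\: S) :&: O|)%N.
  by rewrite -(cardsID S) setIAC [T :&: S]setIC setIDAC.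
have cTN : (#|T :\: O| = #|(S :&: T) :\: O| + #|(T :\: S) :\: O|)%N.
  by rewrite -(cardsID S) setIDAC [T :&: S]setIC setDDl [O :|: S]setUC -setDDl.
have cX : (#|(X :|: S :\: T) :&: O| <= #|X :&: O| + #|Z|)%N.
  by rewrite setIUl cardsU leq_subr.
move: NZO cX gain expZ; rewrite cSO cSN cTO cTN cZ cY.
rewrite -!(ler_nat R) !natrD.
move=> NZ_le cX gain expZ bndO.
(* Half of [gain], plus [(s - 1) / 2] times [#|(T :\: S) :\: O| >= s * #|Z|]. *)
set z := #|Z|%:R in cX gain expZ bndO *.
set y := #|(T :\: S) :\: O|%:R in NZ_le gain *.
have : (s - 1) * (s * z) <= (s - 1) * y.
  by rewrite ler_wpM2l ?subr_ge0 ?(ltW s1) ?(le_trans expZ NZ_le).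
rewrite mulrA mulrBl mul1r s2 => ?; lra.
Qed.

(** This strict growth, due to [Num.sqrt 3 > 1], makes repeated exchanging terminate. *)
Lemma admissible_card (R : realType) n (G : input n) S X T :
  admissible R n G S X T -> (#|S| < #|T|)%N.
Proof.
case/and4P=> _ _ TS gain; have s1 := sqrt3_gt1 R.
rewrite -(cardsID T S) -(cardsID S T) setIC ltn_add2l.
have [ST0|ST0] := posnP #|S :\: T|.
  rewrite ST0 card_gt0; apply: contraNneq TS => TS0.
  by rewrite eqEsubset -!setD_eq0 -!cards_eq0 TS0 ST0 cards0.
rewrite -(ltr_nat R); apply: lt_le_trans gain.
by rewrite -[X in X < _]mul1r ltr_pM2r // ltr0n.
Qed.

(** As long as exchanges occur, [k] of them leave at least [k] accepted vertices, so [n.+1] rounds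
    suffice; [run] performs exactly that many per arrival. *)
Lemma iter_exchange_final (R : realType) n (G : input n) st T :
  let st' := iter n.+1 (exchange R n G) st in
  ~~ admissible R n G st'.1 st'.2 T.
Proof.
have grow k : let st' := iter k (exchange R n G) st in
    (forall T, ~~ admissible R n G st'.1 st'.2 T) \/ (k <= #|st'.1|)%N.
  elim: k => [|k]; first by right.
  rewrite iterS; case: (iter k _ _) => S X IH.
  case: (exchangeP R n G S X) => [noT|T' admT' _]; first by left.
  case: IH => [/(_ T')|kS]; first by rewrite admT'.
  by right; apply: leq_ltn_trans kS (admissible_card _ _ _ _ _ _ admT').
move: (grow n.+1); set st' := iter _ _ _ => -[//|]; rewrite leqNgt => /negP[].
by rewrite ltnS -[X in (_ <= X)%N]card_ord max_card.
Qed.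

Lemma no_admissible_OPT (R : realType) n (G : input n) S X :
  invariant_state R n G (S, X) -> (forall T, ~~ admissible R n G S X T) ->
  (OPT G)%:R <= 3 * Num.sqrt 3 / 2 * #|S|%:R :> R.
Proof.
move=> [/= /independentP indS dSX bnd] noT; have s1 := sqrt3_gt1 R.
rewrite /OPT; elim/big_ind: _ => [|i j|O indO].
- by rewrite mulr_ge0 ?divr_ge0 ?mulr_ge0 ?sqrtr_ge0.
- by case: (leqP i j).
have OB := bnd O indO; have /independentP indO' := indO.
pose O' := O :\: X.
(* [T] adopts all of [O] still available and keeps every vertex of [S] compatible with it. It loses
   only vertices outside [O]. *)
pose T := O' :|: [set v in S | [forall u in O', ~~ adj G u v]].
have indT : independent G T.
  apply/independentP => u v; rewrite 2!in_setU => /orP[uO|uS] /orP[vO|vS].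
  - by apply: indO'; [move: uO|move: vO]; rewrite inE => /andP[].
  - by move: vS; rewrite inE => /andP[_ /forall_inP]; apply.
  - by rewrite adj_sym; move: uS; rewrite inE => /andP[_ /forall_inP]; apply.
  - by apply: indS; [move: uS|move: vS]; rewrite inE => /andP[].
have dTX : [disjoint T & X].
  rewrite -setI_eq0 setIUl -subset0 subUset; apply/andP; split.
    by apply/subsetP => v; rewrite !inE; case: (v \in X); rewrite ?andbF.
  rewrite subset0 setI_eq0; apply: disjointWl dSX.
  by apply/subsetP => v; rewrite inE => /andP[].
have sTS : O' :\: S \subset T :\: S.
  by apply: setSD; apply: subsetUl.
have sST : S :\: T \subset S :\: O.
  apply/subsetP => v; rewrite !in_setD => /andP[vT vS]; rewrite vS andbT.
  apply: contra vT => vO; rewrite in_setU in_setD vO.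
  by rewrite (disjointFr dSX vS).
have new_le : #|O' :\: S|%:R <= Num.sqrt 3 * #|S :\: O|%:R :> R.
  have [TS|TS] := eqVneq T S.
    move: sTS; rewrite TS setDv subset0 => /eqP->.
    by rewrite cards0 mulr_ge0 ?sqrtr_ge0.
  have := noT T; rewrite /admissible indT dTX TS /= -ltNge => /ltW gain.
  apply: (@le_trans _ _ #|T :\: S|%:R); first by rewrite ler_nat subset_leq_card.
  apply: le_trans gain _; rewrite ler_wpM2l ?sqrtr_ge0 // ler_nat.
  exact: subset_leq_card.
have cO : (#|O| <= #|X :&: O| + (#|S :&: O| + #|O' :\: S|))%N.
  rewrite -(cardsID X O) setIC leq_add2l -/O' -(cardsID S O') leq_add2r.
  by rewrite subset_leq_card // setIC setIS // subsetDl.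
move: cO OB new_le; rewrite -(cardsID O S) -(ler_nat R) !natrD.
set s := Num.sqrt 3 in s1 *; set a := #|S :&: O|%:R; set b := #|S :\: O|%:R.
have a0 : 0 <= a by []. have b0 : 0 <= b by [].
(* The two bounds give [a] only the coefficient [3 / 2]; this slack raises it to [3 * s / 2]. *)
have : 0 <= (s - 1) * a by rewrite mulr_ge0 // subr_ge0 ltW.
move=> h1 h2 h3 h4; lra.
Qed.

(** * The online run and the late-rejection constraint *)

Definition widen_set k (S : {set 'I_k}) : {set 'I_k.+1} :=
  [set widen_ord (leqnSn k) v | v in S].

(* The second component is the set of all vertices ever removed by an exchange;
   it contains the late-rejected ones, but also those that were accepted and
   removed within one step. *)
Fixpoint run (R : realType) k : input k -> {set 'I_k} * {set 'I_k} :=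
  match k with
  | 0 => fun=> (set0, set0)
  | k'.+1 => fun G =>
      let st := run R k' (prefix_input G (leqnSn k')) in
      iter k'.+2 (exchange R k'.+1 G) (widen_set k' st.1, widen_set k' st.2)
  end.

Lemma runS (R : realType) k (G : input k.+1) :
  let st := run R k (prefix_input G (leqnSn k)) in
  run R k.+1 G =
    iter k.+2 (exchange R k.+1 G) (widen_set k st.1, widen_set k st.2).
Proof. by []. Qed.

(** The new vertex is in neither set, so [O] can be replaced by its trace [O'] on the earlier
    vertices. *)
Lemma widen_invariant (R : realType) k (G : input k.+1) st :
  invariant_state R k (prefix_input G (leqnSn k)) st ->
  invariant_state R k.+1 G (widen_set k st.1, widen_set k st.2).
Proof.
have winj : injective (widen_ord (leqnSn k)) by move=> u v [] /val_inj.
case: st => S X [/= /independentP indS dSX bnd]; split=> /=.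
- apply/independentP => _ _ /imsetP[u uS ->] /imsetP[v vS ->].
  by have := indS u v uS vS; rewrite mxE.
- rewrite -setI_eq0 -imsetI; last by move=> u v _ _ /winj.
  by rewrite (disjoint_setI0 dSX) imset0.
move=> O /independentP indO.
pose O' := [set v | widen_ord (leqnSn k) v \in O].
have interO (A : {set 'I_k}) : #|widen_set k A :&: O| = #|A :&: O'|.
  rewrite -(card_imset _ winj); congr #|pred_of_set _|; apply/setP => v.
  apply/setIP/imsetP => [[/imsetP[u uA ->] uO]|[u]].
    by exists u => //; rewrite !inE uA.
  by rewrite !inE => /andP[uA uO] ->; rewrite imset_f.
have diffO (A : {set 'I_k}) : #|widen_set k A :\: O| = #|A :\: O'|.
  apply/eqP; rewrite -(eqn_add2l #|widen_set k A :&: O|) cardsID interO cardsID.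
  by rewrite card_imset.
rewrite !interO diffO; apply: bnd; apply/independentP => u v.
by rewrite !inE => uO vO; rewrite mxE indO.
Qed.

Lemma run_invariant (R : realType) k (G : input k) :
  invariant_state R k G (run R k G).
Proof.
elim: k G => [|k IH] G.
  split=> /=; first by apply/independentP => u; rewrite inE.
    by rewrite -setI_eq0 setI0.
  by move=> O _ /=; rewrite !set0I set0D cards0 !mulr0 addr0.
rewrite runS; elim: k.+2 => [|m IHm]; first exact/widen_invariant/IH.
by rewrite iterS; apply: exchange_invariant.
Qed.

(** A vertex can leave the accepted set only by entering the discarded set, which it never
    leaves. *)
Lemma exchange_mono (R : realType) n (G : input n) st :
  let st' := exchange R n G st in
  st.2 \subset st'.2 /\ st.1 :|: st.2 \subset st'.1 :|: st'.2.
Proof.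
case: st => S X; case: (exchangeP R n G S X) => [//|T _ _] /=.
split; first exact: subsetUl.
apply/subsetP => v; rewrite !inE.
by case: (v \in T); case: (v \in X); case: (v \in S).
Qed.

Lemma run_mono (R : realType) k (G : input k.+1) :
  let st := run R k (prefix_input G (leqnSn k)) in
  let st' := run R k.+1 G in
  widen_set k st.2 \subset st'.2 /\
  widen_set k st.1 :|: widen_set k st.2 \subset st'.1 :|: st'.2.
Proof.
move=> st st'; rewrite {}/st' runS -/st.
elim: k.+2 => [//|m [IH1 IH2]]; rewrite iterS.
have [E1 E2] := exchange_mono R k.+1 G
  (iter m (exchange R k.+1 G) (widen_set k st.1, widen_set k st.2)).
by split; [exact: subset_trans IH1 E1|exact: subset_trans IH2 E2].
Qed.

Definition exchange_algorithm (R : realType) : online_algorithm :=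
  fun k G => (run R k G).1.

Lemma prefix_prefix n (G : input n) j k (le_jk : (j <= k)%N) (le_kn : (k <= n)%N)
    (le_jn : (j <= n)%N) :
  prefix_input (prefix_input G le_kn) le_jk = prefix_input G le_jn.
Proof.
apply: val_inj; apply/matrixP => u v; rewrite !mxE.
by congr (adj G _ _); apply: val_inj.
Qed.

(** A vertex accepted at [i] but not at [j] is discarded by time [j], remains so at [k], and the two
    sets are disjoint at [k]. *)
Lemma exchange_late_accept_reject (R : realType) :
  late_accept_reject (exchange_algorithm R).
Proof.
move=> n G; split; first by have [] := run_invariant R n G.
pose acc k (le_kn : (k <= n)%N) :=
  [set widen_ord le_kn v | v in (run R k (prefix_input G le_kn)).1].
pose rej k (le_kn : (k <= n)%N) :=
  [set widen_ord le_kn v | v in (run R k (prefix_input G le_kn)).2].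
have winj k (le_kn : (k <= n)%N) : injective (widen_ord le_kn).
  by move=> u v [] /val_inj.
have mono i (le_in : (i <= n)%N) d (le_kn : (i + d <= n)%N) :
    rej i le_in \subset rej _ le_kn /\
    acc i le_in :|: rej i le_in \subset acc _ le_kn :|: rej _ le_kn.
  elim: d le_kn => [|d IH].
    by rewrite addn0 => le_kn; rewrite (bool_irrelevance le_kn le_in).
  rewrite addnS => lt_kn; have [IH1 IH2] := IH (ltnW lt_kn).
  have [] := run_mono R _ (prefix_input G lt_kn).
  rewrite prefix_prefix; first exact: ltnW.
  move=> le_kn; move: IH1 IH2; rewrite (bool_irrelevance (ltnW lt_kn) le_kn).
  move=> IH1 IH2 M1 M2.
  have widenE (A : {set 'I_(i + d)}) :
      widen_ord lt_kn @: widen_set _ A = widen_ord le_kn @: A.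
    by rewrite -imset_comp; apply: eq_imset => v; apply: val_inj.
  split; [apply: subset_trans IH1 _|apply: subset_trans IH2 _].
    by rewrite /rej -widenE imsetS.
  by have := imsetS (widen_ord lt_kn) M2; rewrite 2!(imsetU (widen_ord lt_kn)) !widenE.
move=> k; rewrite disjoint_subset; apply/subsetP => v vk.
rewrite !inE; apply/existsP => -[i /existsP[j /and4P[lt_ij le_jk vi vj]]].
have rej_mono (p q : nat) (lp : (p <= n)%N) (lq : (q <= n)%N) : (p <= q)%N ->
    rej p lp \subset rej q lq /\
    acc p lp :|: rej p lp \subset acc q lq :|: rej q lq.
  by move=> pq; move: lq; rewrite -(subnKC pq) => lq; apply: mono.
have [_ /subsetP/(_ v)] := rej_mono i j (ltn_ord i) (ltn_ord j) (ltnW lt_ij).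
rewrite in_setU vi => /(_ isT); rewrite in_setU (negPf vj) /= => vrj.
have [/subsetP/(_ v vrj) vrk _] := rej_mono j k (ltn_ord j) (ltn_ord k) le_jk.
case/imsetP: vk => w wA vw; case/imsetP: vrk => w' wR vw'.
have := run_invariant R k (prefix_input G (ltn_ord k)) => -[_ /disjointFr d _].
by rewrite vw in vw'; move/winj: vw' wR => <-; rewrite (d _ wA).
Qed.

Lemma exchange_strictly_competitive (R : realType) :
  strictly_competitive (exchange_algorithm R) (3 * Num.sqrt 3 / 2 : R).
Proof.
move=> n G; rewrite addr0 /ALG /exchange_algorithm.
have := run_invariant R n G.
case E : (run R n G) => [S X] inv /=; apply: no_admissible_OPT inv _ => T.
(* For [n = 0] no exchange is run, but an admissible [T] would have to be nonempty. *)
case: n G S X T E => [|n] G S X T.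
  case=> <- <-; apply/negP => /admissible_card.
  by rewrite cards0 ltnNge -[X in (_ <= X)%N]card_ord max_card => /negP[].
rewrite runS => E.
have := iter_exchange_final R n.+1 G
  (let st := run R n (prefix_input G (leqnSn n)) in
   (widen_set n st.1, widen_set n st.2)) T.
by rewrite [iter _ _ _]E.
Qed.

(** * The adversary *)

Lemma count_iota_le (p q : pred nat) m n : (m <= n)%N ->
  (forall v, (v < m)%N -> p v -> q v) ->
  (count p (iota 0 m) <= count q (iota 0 n))%N.
Proof.
move=> le_mn pq; rewrite -(subnKC le_mn) iotaD count_cat.
apply: leq_trans (leq_addr _ _); rewrite -!size_filter.
apply: uniq_leq_size; first by rewrite filter_uniq ?iota_uniq.
move=> v; rewrite !mem_filter mem_iota add0n => /andP[pv vm].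
by rewrite vm andbT pq.
Qed.

(* [f v] is the side of vertex [v], and [a k v] says that [v] is accepted after
   [k] arrivals. *)
Lemma switching_recurrence (R : realType) (c alpha : R) (N : nat)
    (f : nat -> bool) (a : nat -> pred nat) :
  1 <= c -> c * (`|alpha| + 1) + `|alpha| < N%:R ->
  (forall k v, a k v -> (v < k)%N) ->
  (forall k u v, a k u -> a k v -> f u = f v) ->
  (forall i j k v, (i < j)%N -> (j <= k)%N -> a i v -> ~~ a j v -> ~~ a k v) ->
  (forall b k, (count (fun v => f v == b) (iota 0 k))%:R <=
     c * (count (a k) (iota 0 k))%:R + alpha) ->
  (forall k, f k = (N <= k)%N && ~~ has (fun v => a k v && f v) (iota 0 k)) ->
  exists G : nat -> R,
    (forall i, 0 < G i) /\ (forall i, G i.+3 <= c * (G i.+2 - G i)).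
Proof.
move=> c1 N_large a_lt a_ind a_late comp adv.
have c_gt0 : 0 < c := lt_le_trans ltr01 c1.
have [al_ge0 al_le] : 0 <= `|alpha| /\ alpha <= `|alpha|.
  by split; [exact: normr_ge0|exact: ler_norm].
(* The side occupied after [k] arrivals, with [false] as the default when nothing is accepted. *)
pose side k := has (fun v => a k v && f v) (iota 0 k).
have f_side k : (N <= k)%N -> f k = ~~ side k by move=> Nk; rewrite adv Nk.
have a_side k v : a k v -> f v = side k.
  move=> av; case fv: (f v); apply/esym.
    by apply/hasP; exists v; rewrite ?mem_iota ?add0n ?a_lt // av fv.
  by apply/hasP => -[w _ /andP[aw fw]]; rewrite (a_ind _ _ _ av aw) fw in fv.
(* If the algorithm stayed on one side from [K0] to [L], all vertices arriving meanwhile would join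
   the other side. It would hold at most [K0] vertices against [L - K0], which is too many for
   [comp]. *)
have switch K : exists e, [&& (N <= e)%N, (K <= e)%N & side e.+1 != side e].
  pose K0 := maxn N K.
  pose L := (K0 + (Num.bound (c * K0%:R + `|alpha|)).+1)%N.
  have [/hasP[e]|noswitch] :=
      boolP (has (fun e => side e.+1 != side e) (iota K0 (L - K0))).
    rewrite mem_iota geq_max => /andP[/andP[Ne Ke] _] se.
    by exists e; rewrite Ne Ke.
  exfalso.
  have const d : (K0 + d <= L)%N -> side (K0 + d)%N = side K0.
    elim: d => [|d IH]; first by rewrite addn0.
    rewrite addnS => lt_dL; rewrite -IH ?(ltnW lt_dL) //.
    apply/eqP; apply: contraNT noswitch => sd; apply/hasP.
    exists (K0 + d)%N => //; rewrite mem_iota leq_addr subnKC //.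
    exact: leq_trans (leq_addr d K0) (ltnW lt_dL).
  have fL v : (K0 <= v < L)%N -> f v = ~~ side K0.
    case/andP=> K0v vL; rewrite f_side; last by apply: leq_trans K0v; apply: leq_maxl.
    by rewrite -(subnKC K0v) const ?subnKC // ltnW.
  have le_K0L : (K0 <= L)%N by apply: leq_addr.
  have sL : side L = side K0 by rewrite -(subnKC le_K0L) const // subnKC.
  have aL : (count (a L) (iota 0 L) <= K0)%N.
    rewrite -[K0 in (_ <= K0)%N](size_iota 0) -count_predT.
    rewrite -[in iota 0 L](subnKC le_K0L) iotaD count_cat add0n.
    rewrite -[X in (_ <= X)%N]addn0; apply: leq_add; first exact: sub_count.
    rewrite leqNgt -has_count; apply/hasPn => v.
    rewrite mem_iota subnKC // => vKL; apply/negP => /a_side.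
    by rewrite fL // sL; case: (side K0).
  have ML : (L - K0 <= count (fun v => f v == ~~ side K0) (iota 0 L))%N.
    rewrite -[in iota 0 L](subnKC le_K0L) iotaD count_cat add0n.
    apply: leq_trans (leq_addl _ _).
    rewrite -[X in (X <= _)%N](size_iota K0) leq_eqVlt eq_sym -all_count.
    apply/orP; left; apply/allP => v; rewrite mem_iota subnKC // => vKL.
    by rewrite fL.
  have := comp (~~ side K0) L; apply/negP; rewrite -ltNge.
  apply: (@lt_le_trans _ _ (L - K0)%:R); last by rewrite ler_nat.
  apply: (@le_lt_trans _ _ (c * K0%:R + `|alpha|)).
    by apply: lerD => //; rewrite ler_wpM2l ?ler_nat // ltW.
  have B : c * K0%:R + `|alpha| < (Num.bound (c * K0%:R + `|alpha|))%:R.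
    by apply: archi_boundP; rewrite addr_ge0 // mulr_ge0 // ltW.
  by apply: lt_le_trans B _; rewrite ler_nat /L addKn.
pose nxt K := ex_minn (switch K).
(* [e i] is the end of the i-th period: the algorithm changes sides between
   times [e i] and [(e i).+1]. *)
pose e := fix e i := if i is i'.+1 then nxt (e i').+1 else nxt 0%N.
have e_spec i : (N <= e i)%N /\ side (e i).+1 != side (e i).
  by case: i => [|i] /=; rewrite /nxt; case: ex_minnP => m /and3P[].
have e_lt i : (e i < e i.+1)%N.
  by rewrite /= /nxt; case: ex_minnP => m /and3P[].
have side_const i k : (e i < k)%N -> (k <= e i.+1)%N -> side k = side (e i).+1.
  move=> lt_k; rewrite -(subnKC lt_k); elim: (k - _)%N => [|d IH].
    by rewrite addn0.
  rewrite addnS => le_k; rewrite -(IH (ltnW le_k)); apply/eqP.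
  apply: contraTT le_k => sd; rewrite -leqNgt /= /nxt.
  case: ex_minnP => m _; apply; rewrite sd leq_addr !andbT.
  by have [Ne _] := e_spec i; apply: leq_trans Ne _; rewrite addSn -addnS leq_addr.
have side_next i : side (e i.+1) = ~~ side (e i).
  rewrite (side_const i) //; have [_] := e_spec i.
  by case: (side _); case: (side _).
pose seen k v := has (fun j => a j v) (iota 0 k.+1).
pose H i := count (fun v => seen (e i) v && (f v == side (e i))) (iota 0 (e i)).
pose h i := count (a (e i)) (iota 0 (e i)).
have a_seen j k v : (j <= k)%N -> a j v -> seen k v.
  by move=> jk av; apply/hasP; exists j; rewrite // mem_iota add0n ltnS.
(* Between [e i] and [e i.+1] only the vertex [e i] itself joins side [b], as it arrives just before
   the switch; hence the extra 1. *)
have H_next i : (H i.+1)%:R <= c * (h i)%:R + `|alpha| + 1.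
  set b := side (e i.+1).
  apply: (@le_trans _ _ (count (fun v => f v == b) (iota 0 (e i))).+1%:R).
    rewrite ler_nat; apply: (@leq_trans (count (fun v => f v == b) (iota 0 (e i.+1)))).
      by apply: sub_count => v /andP[].
    rewrite -[in iota 0 (e i.+1)](subnKC (e_lt i)) iotaD count_cat add0n.
    rewrite -[X in (_ <= X)%N]addn0; apply: leq_add.
      rewrite -[in iota 0 (e i).+1]addn1 iotaD count_cat.
      rewrite -[X in (_ <= X)%N]addn1 leq_add2l /= addn0.
      by case: eqP.
    rewrite leqNgt -has_count; apply/hasPn => v.
    rewrite mem_iota subnKC // => /andP[lt_v v_lt].
    have Nv : (N <= v)%N.
      by have [Ne _] := e_spec i; apply: leq_trans Ne (ltnW lt_v).
    rewrite f_side // /b (side_const i v lt_v (ltnW v_lt)) (side_const i) //.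
    by case: (side _).
  by rewrite -natr1 lerD2r; apply: le_trans (comp b (e i)) _; rewrite lerD2l.
(* Vertices counted by [H i] are all dropped at time [(e i).+1], so none of them is held at
   [e i.+2], when the algorithm is back on their side. *)
have h_le i : (h i.+2 + H i <= H i.+2)%N.
  have lt2 : (e i < e i.+2)%N := ltn_trans (e_lt i) (e_lt i.+1).
  have side2 : side (e i.+2) = side (e i) by rewrite !side_next negbK.
  pose p v := seen (e i) v && (f v == side (e i)) && (v < e i)%N.
  have Hp : (H i <= count p (iota 0 (e i.+2)))%N.
    by apply: count_iota_le (ltnW lt2) _ => v vi; rewrite /p vi andbT.
  apply: leq_trans (leq_add (leqnn _) Hp) _; rewrite /h -count_predUI.
  rewrite [X in (_ + X)%N](_ : _ = 0)%N ?addn0; last first.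
    apply/eqP; rewrite -leqn0 leqNgt -has_count; apply/hasPn => v _ /=.
    apply/negP => /andP[a2 /andP[/andP[/hasP[j ji aj] /eqP fv] _]].
    move: ji; rewrite mem_iota add0n => /andP[_ ji].
    move: a2; apply/negP; apply: (a_late j (e i).+1 _ v ji lt2 aj).
    apply/negP => /a_side; rewrite fv => /esym/eqP; apply/negP.
    by have [] := e_spec i.
  apply: sub_count => v /= /orP[a2|/andP[/andP[/hasP[j ji aj] fv] _]].
    by rewrite (a_seen _ _ _ (leqnn _) a2) (a_side _ _ a2) eqxx.
  rewrite side2 fv andbT; apply: a_seen aj.
  by move: ji; rewrite mem_iota add0n ltnS => /andP[_ ji]; apply: leq_trans ji (ltnW lt2).
(* The shift absorbs the additive constant of [H_next] and cancels in the difference [G i.+2 - G i].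
   Positivity comes from the first [N] vertices, all on side [false], which force [h i] above
   [|alpha| + 1]. *)
exists (fun i => (H i)%:R - (`|alpha| + 1)); split=> i.
  have hH : (h i <= H i)%N.
    apply: sub_count => v av; apply/andP; split; first exact: a_seen av.
    by rewrite (a_side _ _ av).
  rewrite subr_gt0; apply: lt_le_trans (_ : (h i)%:R <= _); last by rewrite ler_nat.
  rewrite -(ltr_pM2l c_gt0).
  have N_le : (N <= count (fun v => f v == false) (iota 0 (e i)))%N.
    rewrite -[X in (X <= _)%N](size_iota 0) -count_predT.
    apply: count_iota_le => [|v vN _]; first by have [] := e_spec i.
    by rewrite adv leqNgt vN.
  have := comp false (e i); rewrite -/(h i) => comp_i.
  have : N%:R <= (count (fun v => f v == false) (iota 0 (e i)))%:R :> R.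
    by rewrite ler_nat.
  move=> N_le'; lra.
have := H_next i.+2; have := h_le i; rewrite -(ler_nat R) natrD => h1 h2.
have : c * (h i.+2)%:R <= c * ((H i.+2)%:R - (H i)%:R).
  by rewrite ler_wpM2l ?(ltW c_gt0) // lerBrDr.
move=> h3; lra.
Qed.

(** * Adaptive complete bipartite inputs *)

Fact bipartite_simple (f : nat -> bool) n :
  let M : 'M[bool]_n := \matrix_(u, v) (f u != f v) in
  [forall u, forall v, M u v == M v u] && [forall v, ~~ M v v].
Proof.
apply/andP; split; apply/forallP => u; last by rewrite mxE eqxx.
by apply/forallP => v; rewrite !mxE [f u == _]eq_sym.
Qed.

Definition bipartite (f : nat -> bool) n : input n :=
  Input (bipartite_simple f n).

Lemma eq_bipartite f g n : (forall i, (i < n)%N -> f i = g i) ->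
  bipartite f n = bipartite g n.
Proof.
by move=> fg; apply: val_inj; apply/matrixP => u v; rewrite !mxE !fg.
Qed.

Lemma prefix_bipartite f n k (le_kn : (k <= n)%N) :
  prefix_input (bipartite f n) le_kn = bipartite f k.
Proof. by apply: val_inj; apply/matrixP => u v; rewrite !mxE. Qed.

Lemma count_ord k (p : pred nat) : count p (iota 0 k) = #|[set v : 'I_k | p v]|.
Proof.
rewrite -val_enum_ord count_map -size_filter cardE /enum_mem -filter_predI.
by congr size; apply: eq_filter => v; rewrite /= !inE andbT.
Qed.

Lemma bipartite_OPT f n b :
  (count (fun v => f v == b) (iota 0 n) <= OPT (bipartite f n))%N.
Proof.
rewrite count_ord; apply: leq_bigmax_cond; apply/independentP => u v.
by rewrite !inE mxE negbK => /eqP-> /eqP->.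
Qed.

(** The side of vertex [k'] depends on the answer of [A] to the whole graph before it, so the
    recursion carries the side function of all earlier vertices; [adversary] is its diagonal. *)
Fixpoint adversary_prefix (A : online_algorithm) (N k : nat) : nat -> bool :=
  match k with
  | 0 => xpred0
  | k'.+1 => fun i =>
      let f := adversary_prefix A N k' in
      if (i < k')%N then f i
      else (N <= k')%N && ~~ [exists v in A k' (bipartite f k'), f v]
  end.

Definition adversary A N k := adversary_prefix A N k.+1 k.

Lemma adversary_prefixE A N k i : (i < k)%N ->
  adversary_prefix A N k i = adversary A N i.
Proof.
elim: k => // k IH; rewrite ltnS leq_eqVlt => /orP[/eqP->//|lt_ik].
by rewrite [LHS]/= lt_ik IH.
Qed.

Lemma adversaryE A N k : let f := adversary A N in
  f k = (N <= k)%N && ~~ [exists v in A k (bipartite f k), f v].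
Proof.
rewrite {1}/adversary /= ltnn; congr (_ && ~~ _).
rewrite (@eq_bipartite _ (adversary A N)); last exact: adversary_prefixE.
by apply: eq_existsb => v; rewrite adversary_prefixE.
Qed.

Lemma not_competitive (R : realType) (c : R) (A : online_algorithm) :
  c < 3 * Num.sqrt 3 / 2 -> late_accept_reject A -> ~ competitive A c.
Proof.
move=> c_lt lar [alpha comp]; have s1 := sqrt3_gt1 R.
(* Raising [c] to at least 1 keeps the competitive bound, and [c'] is still below the threshold
   because [3 * Num.sqrt 3 / 2 > 1]. *)
pose c' := Num.max c 1.
pose N := Num.bound (c' * (`|alpha| + 1) + `|alpha|).
pose f := adversary A N.
pose a k v := [exists w in A k (bipartite f k), v == val w].
have aE n (k : 'I_n.+1) (v : 'I_n) : (v \in accepted A (bipartite f n) k) = a k v.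
  rewrite /accepted prefix_bipartite; apply/imsetP/exists_inP => -[w wA].
    by move=> ->; exists w.
  by move/eqP=> vw; exists w => //; apply: val_inj.
have c'1 : 1 <= c' by rewrite le_max lexx orbT.
have c'0 : 0 <= c' := le_trans ler01 c'1.
have c'_lt : c' < 3 * Num.sqrt 3 / 2 by rewrite gt_max c_lt; lra.
have a_lt k v : a k v -> (v < k)%N by case/exists_inP=> w _ /eqP->; apply: ltn_ord.
have aA k (v : 'I_k) : a k v = (v \in A k (bipartite f k)).
  apply/exists_inP/idP => [[w wA /eqP/val_inj->]//|vA]; by exists v.
have [||||||G [G_gt0 G_rec]] := switching_recurrence R c' alpha N f a c'1.
- by apply: archi_boundP; rewrite addr_ge0 // mulr_ge0 // addr_ge0.
- exact: a_lt.
- move=> k u v /exists_inP[u' u'A /eqP->] /exists_inP[v' v'A /eqP->].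
  have [/independentP/(_ _ _ u'A v'A) + _] := lar k (bipartite f k).
  by rewrite mxE negbK => /eqP.
- move=> i j k v lt_ij le_jk ai; apply: contraNN => ak.
  have vk := a_lt _ _ ak.
  have [_ /(_ ord_max)] := lar k (bipartite f k).
  move/disjointFr/(_ (_ : Ordinal vk \in _)); rewrite aE => /(_ ak).
  have ik : (i < k.+1)%N by rewrite ltnS ltnW // (leq_trans lt_ij).
  have jk : (j < k.+1)%N by rewrite ltnS.
  apply: contraFT => aj; rewrite inE; apply/existsP; exists (Ordinal ik).
  by apply/existsP; exists (Ordinal jk); rewrite !aE lt_ij le_jk ai.
- move=> b k; apply: (@le_trans _ _ (OPT (bipartite f k))%:R).
    by rewrite ler_nat bipartite_OPT.
  apply: le_trans (comp k _) _; rewrite lerD2r.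
  rewrite count_ord /ALG (_ : [set v : 'I_k | a k v] = A k (bipartite f k)).
    by rewrite ler_wpM2r // le_max lexx.
  by apply/setP => v; rewrite inE aA.
- move=> k; rewrite {1}/f adversaryE -/f; congr (_ && ~~ _).
  apply/exists_inP/hasP => [[v vA fv]|[v]].
    by exists (val v); rewrite ?mem_iota ?add0n ?ltn_ord // aA vA.
  by move=> _ /andP[/exists_inP[w wA /eqP->] fw]; exists w.
exact: no_positive_solution c'0 c'_lt G_gt0 G_rec.
Qed.

Theorem corollary1 (R : realType) :
  (exists A : online_algorithm,
     late_accept_reject A /\
     strictly_competitive A (3 * Num.sqrt 3 / 2 : R)) /\
  (forall c : R, c < 3 * Num.sqrt 3 / 2 ->
     forall A : online_algorithm, late_accept_reject A -> ~ competitive A c).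
Proof.
split; last by move=> c c_lt A lar; apply: not_competitive c_lt lar.
exists (exchange_algorithm R); split; first exact: exchange_late_accept_reject.
exact: exchange_strictly_competitive.
Qed.
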